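(* Let $G$ be a countably infinite abelian group such that $2G$ is finite. If $A\subset G$ has upper Banach density $1$, then for every $t\in A$ there is some infinite $B\subset A$ such that $t+B+B\subset A$.
   Context: $2G=\{g+g: g\in G\}$. A Følner sequence in $G$ is a sequence $\Phi=(\Phi_N)_{N\in\mathbb{N}}$ of (nonempty) finite subsets of $G$ with $\lim_{N\to\infty}\frac{|\Phi_N\cap(g+\Phi_N)|}{|\Phi_N|}=1$ for every $g\in G$. $\overline{\mathrm{d}}_\Phi(A)=\limsup_{N\to\infty}\frac{|A\cap\Phi_N|}{|\Phi_N|}$. The upper Banach density of $A\subset G$ is the supremum of $\overline{\mathrm{d}}_\Phi(A)$ over all Følner sequences $\Phi$ in $G$. $t+B+B=\{t+b_1+b_2: b_1,b_2\in B\}$ (with $b_1=b_2$ allowed). *)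

(* Defs.v *)
From mathcomp Require Import all_boot all_order all_algebra finmap.
From mathcomp Require Import all_classical all_reals all_analysis.
Import Order.TTheory GRing.Theory Num.Theory.
Import numFieldNormedType.Exports.

Set Implicit Arguments.
Unset Strict Implicit.
Unset Printing Implicit Defensive.

Local Open Scope classical_set_scope.
Local Open Scope ring_scope.

Definition translate (G : zmodType) (g : G) (F : {fset G}) : {fset G} :=
  [fset (g + x)%R | x in F]%fset.

Definition folner (R : realType) (G : zmodType) (Phi : nat -> {fset G}) : Prop :=
  (forall N, Phi N != fset0) /\
  forall g : G,
    (#|` (Phi N `&` translate g (Phi N))%fset |%:R / #|` Phi N|%:R : R)
      @[N --> \oo] --> (1 : R).

Definition upper_density (R : realType) (G : zmodType)
    (Phi : nat -> {fset G}) (A : set G) : \bar R :=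
  limn_esup (fun N =>
    (#|` [fset x in Phi N | x \in A]%fset|%:R / #|` Phi N|%:R : R)%:E).

Definition upper_banach_density (R : realType) (G : zmodType) (A : set G) :
    \bar R :=
  ereal_sup [set upper_density R Phi A | Phi in [set Phi | folner R Phi]].

(* Main.v *)
Require Import Defs.
From mathcomp Require Import all_boot all_order all_algebra finmap.
From mathcomp Require Import all_classical all_reals all_analysis.
From mathcomp Require Import lra.
Import Order.TTheory GRing.Theory Num.Theory.
Import numFieldNormedType.Exports.

Set Implicit Arguments.
Unset Strict Implicit.
Unset Printing Implicit Defensive.

Local Open Scope classical_set_scope.
Local Open Scope ring_scope.

(** Write H for the 2-torsion subgroup {h | h + h = 0}.  It is the kernel of
    the doubling map, whose image 2G is finite, so H has finite index, and it
    is infinite because G is.  Elements b of H are harmless on the diagonal: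
    t + b + b = t lies in A by hypothesis.  So it is enough to choose
    pairwise distinct b_0, b_1, ... in H and in A such that t + b_i + b_j lies
    in A whenever i < j.

    A greedy choice works as soon as A contains, for each finite set s, some
    translate g + s with g in H and g outside a prescribed finite set.  Three
    facts give this.

    - Upper Banach density 1 makes A thick, that is, A contains a translate of
      every finite set ([thick_upper_banach_density1]).  For each f in s, an
      element x of a Folner set F with f + x outside A either leaves F under
      the translation by f, or is carried into F minus A.  Both kinds fill an
      arbitrarily small proportion of F, so a union bound over s leaves some x
      with x + s inside A.

    - The translation can be taken in H ([thick_2torsion]).  Apply thickness
      to r + s, where r is a finite family of representatives of the cosets
      of H, then move g into H by one of them.

    - It can moreover avoid a finite set E ([thick_2torsion_avoid]).  Since H
      is infinite, it has an element h outside E - E; of two translations g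
      and g + h, at most one belongs to E. *)

Definition thick (G : zmodType) (A : set G) : Prop :=
  forall s : seq G, exists g, forall f, f \in s -> A (g + f).

Lemma card_fset_filter (T : choiceType) (F : {fset T}) (p : pred T) :
  #|` [fset x in F | p x]%fset| = count p F.
Proof.
rewrite -size_filter; apply/perm_size/uniq_perm.
- exact: fset_uniq.
- by rewrite filter_uniq// fset_uniq.
- by move=> x; rewrite mem_filter !inE andbC.
Qed.

(** Counting from the inside of F, by the points that stay in F, is what can be
    combined with the other counts over F below; the bijection is x |-> g + x
    onto the intersection. *)
Lemma card_setI_translate (G : zmodType) (F : {fset G}) (g : G) :
  #|` (F `&` translate g F)%fset| = count (fun x => g + x \in F) F.
Proof.
rewrite -card_fset_filter.
transitivity #|` [fset (g + y)%R | y in [fset x in F | (g + x)%R \in F]]%fset|; last first.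
  exact: card_imfset (addrI g).
congr #|` _|; apply/fsetP => x; rewrite !inE; apply/andP/imfsetP.
  by move=> [xF /imfsetP[y /= yF xE]]; exists y; rewrite //= !inE yF -xE.
move=> [y /=]; rewrite !inE => /andP[yF gyF] ->; split=> //.
by apply/imfsetP; exists y.
Qed.

(** A point x of F with g + x outside A either leaves F, or g + x is a point of
    F outside A; the second kind is counted by injectivity of translation. *)
Lemma count_not_mem_translate (G : zmodType) (F : {fset G}) (A : set G) (g : G) :
  (count (fun x => (g + x)%R \notin A) F <=
     count (fun x => (g + x)%R \notin F) F + count (fun x => x \notin A) F)%N.
Proof.
apply: (@leq_trans (count (fun x => (g + x)%R \notin F) F +
                    count (fun x => ((g + x)%R \in F) && ((g + x)%R \notin A)) F)).
  rewrite -count_predUI; apply: leq_trans (leq_addr _ _).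
  by apply: sub_count => x /=; case: ((g + x)%R \in F).
rewrite leq_add2l -!size_filter -(size_map (+%R g)); apply: uniq_leq_size.
  by rewrite map_inj_uniq ?filter_uniq ?fset_uniq//; exact: addrI.
move=> _ /mapP[y + ->]; rewrite mem_filter => /andP[/andP[gyF gyA] _].
by rewrite mem_filter gyA.
Qed.

Lemma count_has_le (R : realDomainType) (T I : eqType) (F : seq T) (s : seq I)
    (p : I -> pred T) (c : R) :
  (forall i, i \in s -> (count (p i) F)%:R <= c) ->
  (count (fun x => has (p^~ x) s) F)%:R <= (size s)%:R * c.
Proof.
elim: s => [_|i s IH pc] /=.
  by rewrite (eq_count (a2 := pred0))// count_pred0 mul0r.
have := IH (fun j js => pc j (mem_behead (s := i :: s) js)).
have := pc i (mem_head _ _).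
have : (count (fun x => p i x || has (p^~ x) s) F <=
        count (p i) F + count (fun x => has (p^~ x) s) F)%N.
  by rewrite -count_predUI leq_addr.
rewrite -(ler_nat R) natrD -[(size s).+1]addn1 natrD mulrDl mul1r.
lra.
Qed.

Lemma limn_esup_frequently (R : realType) (u : (\bar R)^nat) (c : \bar R) :
  (c < limn_esup u)%E -> forall P : set nat, (\forall N \near \oo, P N) ->
  exists2 N, P N & (c < u N)%E.
Proof.
move=> cu P nP.
have /ereal_sup_gt[_ [N PN <-] cuN] : (c < ereal_sup [set u x | x in P])%E.
  by apply: (lt_le_trans cu); apply: ereal_inf_lbound; exists P.
by exists N.
Qed.

Lemma thick_upper_banach_density1 (R : realType) (G : zmodType) (A : set G) :
  upper_banach_density R A = 1%E -> thick A.
Proof.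
move=> A1 s.
(* For each f in s, a proportion less than e of F leaves F, and less than e
   lies outside A; the union bound then gives 2 * e * size s < 1. *)
pose e : R := (2 * (size s).+1%:R)^-1.
have e0 : 0 < e by rewrite invr_gt0 mulr_gt0.
have : ((1 - e)%:E < upper_banach_density R A)%E.
  by rewrite A1 lte_fin ltrBlDr ltrDl.
move=> /ereal_sup_gt[_ [Phi [Phi0 PhiF] <-]] /limn_esup_frequently Phid.
have PhiN : \forall N \near \oo, forall f, f \in s ->
    1 - e < #|` (Phi N `&` translate f (Phi N))%fset|%:R / #|` Phi N|%:R.
  elim: s {Phid} e e0 => [|f s IH] e e0; first exact: nearW.
  have := cvgr_gt _ (PhiF f) (1 - e); rewrite ltrBlDr ltrDl => /(_ _ e0) Nf.
  near=> N => h; rewrite inE => /predU1P[->|]; first by near: N.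
  by move: h; near: N; exact: IH.
have [N PN] := Phid _ PhiN.
set F := Phi N in PN *.
have F0 : 0 < #|` F|%:R :> R by rewrite ltr0n cardfs_gt0 Phi0.
rewrite lte_fin ltr_pdivlMr// card_fset_filter => dA.
have bad f : f \in s -> (count (fun x => f + x \notin A) F)%:R <= 2 * e * #|` F|%:R.
  move=> /PN; rewrite ltr_pdivlMr// card_setI_translate => dF.
  have := count_not_mem_translate F A f; rewrite -(ler_nat R) natrD.
  have := count_predC (fun x => f + x \in F) F.
  have := count_predC (fun x => x \in A) F.
  move=> /(congr1 (fun n => n%:R : R)) + /(congr1 (fun n => n%:R : R)).
  rewrite !natrD /predC /= => h1 h2.
  move: h1 h2 dA dF; rewrite -/(#|` F|).
  lra.
have : ~~ all (fun x => has (fun f => f + x \notin A) s) F.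
  rewrite all_count neq_ltn; apply/orP; left; rewrite -(ltr_nat R).
  apply: (le_lt_trans (count_has_le bad)).
  rewrite mulrA gtr_pMl// /e invfM mulVKf ?pnatr_eq0//.
  by rewrite ltr_pdivrMr ?ltr0n// mul1r ltr_nat.
move=> /allPn[x _ /hasPn xA]; exists x => f /xA.
by rewrite negbK addrC => /set_mem.
Unshelve. all: by end_near.
Qed.

(** The list r represents the cosets of the 2-torsion subgroup: the double of a
    point determines its coset, so one representative per element of the finite
    set 2G is enough.  Here it is taken for the coset of - g. *)
Lemma finite_double_reps (G : zmodType) :
  finite_set [set g + g | g in [set: G]] ->
  exists r : seq G, forall g, exists2 x, x \in r & (g + x) + (g + x) = 0.
Proof.
move=> /finite_seqP[D DE].
pose half d : G := xget 0 [set x | x + x = d].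
exists (map half D) => g.
have gD : - g + - g \in D.
  have : [set` D] (- g + - g) by rewrite -DE; exists (- g).
  by [].
exists (half (- g + - g)); first exact: map_f.
have : half (- g + - g) + half (- g + - g) = - g + - g.
  by rewrite /half; case: xgetP => [y _ //|/(_ (- g))]; case.
by move=> hE; rewrite addrACA hE addrACA !subrr addr0.
Qed.

(** A subgroup of finite index in an infinite group is infinite: otherwise
    finitely many of its translates would cover G. *)
Lemma infinite_2torsion (G : zmodType) :
  infinite_set [set: G] -> finite_set [set g + g | g in [set: G]] ->
  infinite_set [set h : G | h + h = 0].
Proof.
move=> Ginf /finite_double_reps[r rP] Hfin; apply: Ginf.
apply: (@sub_finite_set _ _ [set h - x | h in [set h | h + h = 0] & x in [set` r]]).
  move=> g _; have [x xr gx0] := rP g.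
  by exists (g + x) => //; exists x => //; rewrite addrK.
exact: finite_image2.
Qed.

(** Thickness relative to the finite-index subgroup: containing g + x + s for
    every representative x leaves room to correct g into the subgroup. *)
Lemma thick_2torsion (G : zmodType) (A : set G) (s : seq G) :
  finite_set [set g + g | g in [set: G]] -> thick A ->
  exists2 g, g + g = 0 & forall f, f \in s -> A (g + f).
Proof.
move=> /finite_double_reps[r rP] tA.
have [g gA] := tA [seq x + f | x <- r, f <- s].
have [x xr gx0] := rP g.
exists (g + x) => // f fs; rewrite -addrA; apply: gA.
exact: allpairs_f.
Qed.

(** Requiring A to contain both g + s and g + h + s leaves the choice between
    g and g + h, and h outside E - E ensures that one of them avoids E. *)
Lemma thick_2torsion_avoid (G : zmodType) (A : set G) (s E : seq G) :
  infinite_set [set: G] -> finite_set [set g + g | g in [set: G]] -> thick A ->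
  exists g, [/\ g + g = 0, g \notin E & forall f, f \in s -> A (g + f)].
Proof.
move=> Ginf fin2G tA.
have [h [h0 hE]] : ([set h : G | h + h = 0] `\`
    [set` [seq x - y | x <- E, y <- E]]) !=set0.
  apply: infinite_setN0; apply: infinite_setD; first exact: infinite_2torsion.
  exact: finite_seq.
have [g g0 gA] := thick_2torsion (s ++ [seq h + f | f <- s]) fin2G tA.
have [gE|gE] := boolP (g \in E); last first.
  by exists g; split=> // f fs; apply: gA; rewrite mem_cat fs.
exists (g + h); split.
- by rewrite addrACA g0 h0 addr0.
- apply/negP => ghE; apply: hE => /=.
  by rewrite -[h](addKr g) addrC; exact: allpairs_f.
- by move=> f fs; rewrite -addrA; apply: gA; rewrite mem_cat map_f ?orbT.
Qed.

(** The relation is only asked from earlier to later elements, which is what an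
    element chosen after a finite list s can be made to satisfy. *)
Lemma greedy_infinite_set (T : choiceType) (P : set T) (r : T -> T -> Prop) :
  (forall s : seq T, exists x, [/\ P x, x \notin s & forall y, y \in s -> r y x]) ->
  exists b : nat -> T,
    [/\ infinite_set (range b), forall n, P (b n) &
        forall m n, (m < n)%N -> r (b m) (b n)].
Proof.
move=> /choice[next nextP].
pose l n := iter n (fun s => next s :: s) [::].
have lP m n : (m < n)%N -> next (l m) \in l n.
  elim: n => // n IH; rewrite ltnS leq_eqVlt => /predU1P[->|/IH mn].
    exact: mem_head.
  by rewrite /= inE mn orbT.
exists (next \o l); split.
- move=> bfin; apply: infinite_nat.
  apply: sub_finite_set (finite_preimage (f := next \o l) _ bfin).
    by move=> n _; exists n.
  move=> m n _ _ /= bmn; case: (ltngtP m n) => // [/lP|/lP].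
    by rewrite bmn; have [_ /negP] := nextP (l n).
  by rewrite -bmn; have [_ /negP] := nextP (l m).
- by move=> n; have [] := nextP (l n).
- by move=> m n /lP; have [_ _] := nextP (l n); apply.
Qed.

Theorem proposition5p8 (R : realType) (G : zmodType)
    (Gcountable : countable [set: G])
    (Ginfinite : infinite_set [set: G])
    (fin2G : finite_set [set g + g | g in [set: G]])
    (A : set G)
    (A1 : upper_banach_density R A = 1%E) :
  forall t : G, A t ->
    exists B : set G,
      [/\ infinite_set B,
          B `<=` A &
          [set t + b1 + b2 | b1 in B & b2 in B] `<=` A].
Proof.
move=> t At.
have tA := thick_upper_banach_density1 A1.
(* The translate of 0 puts the new element in A, and the translates of t + y
   give the sums with the earlier elements y. *)
have [s|b [binf bP br]] := @greedy_infinite_set G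
    [set g | g + g = 0 /\ A g] (fun x y => A (t + x + y)).
  have [g [g0 gs gA]] :=
    thick_2torsion_avoid (0 :: [seq t + y | y <- s]) s Ginfinite fin2G tA.
  exists g; split=> //.
    by split=> //; rewrite -[g]addr0; apply: gA; exact: mem_head.
  by move=> y ys; rewrite addrC; apply: gA; rewrite inE map_f ?orbT.
exists (range b); split=> //; first by move=> _ [n _ <-]; have [] := bP n.
move=> _ [_ [m _ <-]] [_ [n _ <-] <-].
case: (ltngtP m n) => [/br //|/br|->]; first by rewrite addrAC.
by rewrite -addrA; have [-> _] := bP n; rewrite addr0.
Qed.
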